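(* Let $G$ be a finite nonabelian simple group, $x\in G$ an involution and $\alpha=\sigma_x$. Let $g\in G$ and $\gamma\in\mathrm{Aut}(G)$ with $\gamma\alpha=\alpha\gamma$, and for $c\in G$ put $c^{(g,\gamma)}:=\alpha(g)\gamma(c)g^{-1}$. Then for all $a,b\in G$, $$\{b,\alpha(b^{-1})\}=\{a^{(g,\gamma)},(\alpha(a^{-1}))^{(g,\gamma)}\}$$ if and only if the automorphism $\sigma_g\gamma$ maps the set $\{xa,a^{-1}x\}$ onto the set $\{xb,b^{-1}x\}$.
   Context: For $h\in G$, $\sigma_h\in\mathrm{Inn}(G)$ denotes conjugation $y\mapsto hyh^{-1}$; thus $\sigma_x(y)=xyx$ for an involution $x$. $\sigma_g\gamma$ denotes the composite $y\mapsto g\gamma(y)g^{-1}$. *)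

(* Defs.v *)
From mathcomp Require Import all_boot all_fingroup all_solvable.

Set Implicit Arguments.
Unset Strict Implicit.
Unset Printing Implicit Defensive.

Local Open Scope group_scope.

(* conj_aut G h is y |-> y ^ h = h^-1 * y * h, hence the inverse here;
   see innE below. *)
Definition inn (gT : finGroupType) (G : {group gT}) (h : gT) : {perm gT} :=
  conj_aut G h^-1.

Lemma innE (gT : finGroupType) (G : {group gT}) :
  {in G &, forall h y, inn G h y = h * y * h^-1}.
Proof.
by move=> h y Gh Gy; rewrite /inn conj_autE ?groupV // conjgE invgK mulgA.
Qed.

(* c^(g,gamma), relative to the automorphism alpha. *)
Definition twist (gT : finGroupType) (alpha gamma : {perm gT}) (g c : gT) : gT :=
  alpha g * gamma c * g^-1.

(* Main.v *)
Require Import Defs.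
From mathcomp Require Import all_boot all_fingroup all_solvable.

Local Open Scope group_scope.

(** Since [gamma] commutes with conjugation by [x] and [G] has trivial center,
    [gamma] fixes [x].  Hence left multiplication by [x] carries
    [alpha g * gamma c * g^-1] to [g * gamma (x * c) * g^-1] and
    [alpha c^-1] to [c^-1 * x], so it turns each of the two set equalities
    into the other. *)

Lemma simple_nonabelian_center1 (gT : finGroupType) (G : {group gT}) :
  simple G -> ~~ abelian G -> 'Z(G) = 1.
Proof.
move=> /simpleP[_ /(_ 'Z(G)%G (center_normal G))[] //= defZ] /negP[].
by apply/center_idP.
Qed.

(** Evaluating both composites at [y] shows that [gamma x] and [x] conjugate [gamma y] alike. As
    [gamma] maps [G] onto itself, [x^-1 * gamma x] is central. *)
Lemma Aut_commute_inn_fix (gT : finGroupType) (G : {group gT}) (x : gT)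
    (gamma : {perm gT}) :
  'Z(G) = 1 -> x \in G -> gamma \in Aut G ->
  inn G x * gamma = gamma * inn G x -> gamma x = x.
Proof.
move=> Z1 Gx AutG cxg.
have Ggamma y : y \in G -> gamma y \in G by move=> Gy; apply: Aut_closed.
have /morphicP gammaM := Aut_morphic AutG.
suff: x^-1 * gamma x \in 'Z(G).
  by rewrite Z1 => /set1P/(canRL (mulKVg x)); rewrite mulg1.
apply/centerP; split=> [|z Gz]; first by rewrite groupM ?groupV ?Ggamma.
have /imsetP[y Gy ->]: z \in gamma @: G.
  by rewrite -(autmE AutG) -morphimEdom im_autm.
have := congr1 (fun s : {perm gT} => s y) cxg.
rewrite !permM !innE ?Ggamma // !gammaM ?groupM ?groupV //.
have -> : gamma x^-1 = (gamma x)^-1 by rewrite -!(autmE AutG) morphV.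
move/(canRL (mulgKV _)) => eq_xy.
by rewrite /commute -[LHS]mulgA eq_xy !mulgA mulVg mul1g.
Qed.

(* Products in {perm gT} are composed left to right: (s * t) y = t (s y), so
   sigma_g o gamma is gamma * inn G g. *)
Theorem theorem2p7 (gT : finGroupType) (G : {group gT})
    (simpleG : simple G) (nonabG : ~~ abelian G)
    (x : gT) (Gx : x \in G) (invol_x : #[x] = 2)
    (alpha : {perm gT}) (def_alpha : alpha = inn G x)
    (g : gT) (Gg : g \in G)
    (gamma : {perm gT}) (AutGgamma : gamma \in Aut G)
    (comm_gamma_alpha : alpha * gamma = gamma * alpha)
    (a b : gT) (Ga : a \in G) (Gb : b \in G) :
  [set b; alpha b^-1]
    = [set twist alpha gamma g a; twist alpha gamma g (alpha a^-1)]
  <-> (gamma * inn G g) @: [set x * a; a^-1 * x] = [set x * b; b^-1 * x].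
Proof.
subst alpha.
have Z1 := simple_nonabelian_center1 _ _ simpleG nonabG.
have fix_x := Aut_commute_inn_fix _ _ _ _ Z1 Gx AutGgamma comm_gamma_alpha.
have xx : x * x = 1 by rewrite -(expg_order x) invol_x expgS expg1.
have xV : x^-1 = x by apply/eqP; rewrite eq_invg_mul xx.
have x_alphaV c : c \in G -> x * inn G x c^-1 = c^-1 * x.
  by move=> Gc; rewrite innE ?groupV // xV !mulgA xx mul1g.
have x_twist c : c \in G ->
    x * twist (inn G x) gamma g c = (gamma * inn G g) (x * c).
  move=> Gc; rewrite /twist permM !innE ?Aut_closed ?groupM //.
  by rewrite (morphicP (Aut_morphic AutGgamma)) // fix_x xV !mulgA xx mul1g.
have Galpha : inn G x a^-1 \in G by rewrite innE ?groupM ?groupV.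
(* With [a^-1 * x] and [b^-1 * x] rewritten with [x] in front, the equality on the right becomes the
   one on the left with every element multiplied by [x], an injective operation. *)
rewrite -(x_alphaV a Ga) -(x_alphaV b Gb) imsetU1 imset_set1 -!x_twist //.
have mul_set2 u v : [set x * u; x * v] = mulg x @: [set u; v].
  by rewrite imsetU1 imset_set1.
rewrite !mul_set2.
by split=> [-> | /(imset_inj (mulgI x))->].
Qed.
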